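(* Let $\omega=e^{\pi i/3}$ and let $\Gamma=\langle A,B\rangle\subset \mathrm{PSL}_2\mathbb{C}$ with $A=\begin{pmatrix}1&1\\0&1\end{pmatrix}$, $B=\begin{pmatrix}1&0\\ \omega&1\end{pmatrix}$. If $X,Y\in\Gamma$ satisfy $\Gamma=\langle X,Y\rangle$ and $\mathrm{tr}\,X=\mathrm{tr}\,Y$, then $X$ and $Y$ are parabolic.
   Context: $\Gamma$ is the image of the discrete faithful representation of the figure-eight knot group $\pi_1(S^3\smallsetminus K)=\langle a,b\mid a^{-1}bab^{-1}a=ba^{-1}bab^{-1}\rangle$ via $a\mapsto A$, $b\mapsto B$; it is a finite-covolume Kleinian subgroup of $\mathrm{PSL}_2(\mathbb{Z}[\omega])$. Traces of elements of $\mathrm{PSL}_2\mathbb{C}$ are taken of lifts to $\mathrm{SL}_2\mathbb{C}$ (so are defined up to sign); ''$\mathrm{tr}\,X=\mathrm{tr}\,Y$'' means the elements admit lifts of equal trace. An element is parabolic if it is non-identity with $\mathrm{tr}^2=4$. *)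

(* Defs.v *)
From HB Require Import structures.
From mathcomp Require Import all_boot all_order all_algebra all_field.
Set Implicit Arguments. Unset Strict Implicit. Unset Printing Implicit Defensive.
Import Order.TTheory GRing.Theory Num.Theory.
Local Open Scope ring_scope.

(* omega = e^{pi i/3} = (1 + i sqrt 3)/2 *)
Definition omega : algC := (1 + 'i * sqrtC 3) / 2.

Definition mA : 'M[algC]_2 := \matrix_(i < 2, j < 2)
  (if (i == 1) && (j == 0) then 0 else 1).
Definition mB : 'M[algC]_2 := \matrix_(i < 2, j < 2)
  (if (i == 0) && (j == 1) then 0 else if (i == 1) && (j == 0) then omega else 1).

(* word_in X Y M : M is a product of X, Y, X^-1, Y^-1 (the subgroup of
   GL_2 generated by X and Y, when det X = det Y = 1). *)
Inductive word_in (X Y : 'M[algC]_2) : 'M[algC]_2 -> Prop :=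
| word_one : word_in X Y 1%:M
| word_X  M : word_in X Y M -> word_in X Y (M *m X)
| word_Xi M : word_in X Y M -> word_in X Y (M *m invmx X)
| word_Y  M : word_in X Y M -> word_in X Y (M *m Y)
| word_Yi M : word_in X Y M -> word_in X Y (M *m invmx Y).

(* M is an SL_2 lift of an element of Gamma = <A,B> in PSL_2 *)
Definition in_Gamma (M : 'M[algC]_2) : Prop := word_in mA mB M \/ word_in mA mB (- M).

(* <X,Y> = Gamma in PSL_2 (given X, Y in Gamma): every element of Gamma
   lies, up to sign, in the group generated by X and Y. *)
Definition generates_Gamma (X Y : 'M[algC]_2) : Prop :=
  forall g, word_in mA mB g -> word_in X Y g \/ word_in X Y (- g).

(* traces agree up to sign (equal for suitable lifts) *)
Definition tr_eq_pm (X Y : 'M[algC]_2) : Prop := \tr X = \tr Y \/ \tr X = - \tr Y.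

(* parabolic in PSL_2: non-identity (X <> +-1) with tr^2 = 4 *)
Definition parabolic (X : 'M[algC]_2) : Prop :=
  X <> 1%:M /\ X <> - 1%:M /\ \tr X ^+ 2 = 4.

(* Main.v *)
(* Let C = XY - YX and O = Z[omega].  Since C X = X^-1 C and C Y = Y^-1 C, every
   commutator MN - NM of words in X and Y has the form K C with K over O.
   Applied to +-A and +-B, whose commutator has determinant of absolute value 1,
   this makes det C a unit of O.  With x = tr X = +-tr Y and z = +-tr XY,
   det C = (2 - z)(z + 2 - x^2), so u = 2 - z and v = z + 2 - x^2 are both units
   and x^2 = 4 - u - v.  The only such square in O is 4. *)
Require Import Defs.
From mathcomp Require Import all_boot all_order all_algebra all_field.
From mathcomp Require Import ring zify.
Import Order.TTheory GRing.Theory Num.Theory.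
Local Open Scope ring_scope.

(** * Arithmetic of the Eisenstein integers O = Z[[omega]] *)

Definition eisenstein (x : algC) : Prop :=
  exists a b : int, x = a%:~R + b%:~R * omega.

Definition eisenstein_mx n (M : 'M[algC]_n) : Prop :=
  forall i j, eisenstein (M i j).

Lemma omega_sq : omega ^+ 2 = omega - 1.
Proof.
have i2 : ('i : algC) ^+ 2 = -1 by exact: sqrCi.
have s2 : sqrtC 3 ^+ 2 = 3 :> algC by exact: sqrtCK.
by rewrite /omega; field: i2 s2.
Qed.

Lemma omega_conj : omega^* = 1 - omega.
Proof.
rewrite /omega fmorph_div rmorphD rmorphM rmorph1 /= conjCi rmorph_nat.
have -> : (sqrtC 3)^* = sqrtC 3 :> algC.
  by apply/CrealP; rewrite ger0_real // sqrtC_ge0 ler0n.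
by field.
Qed.

(** The norm form of O: [omega] and its conjugate have sum 1 and product 1. *)
Lemma normC_eisenstein (a b : int) :
  `|a%:~R + b%:~R * omega : algC| ^+ 2 = (a ^+ 2 + a * b + b ^+ 2)%:~R.
Proof.
rewrite normCK rmorphD rmorphM /= !rmorph_int omega_conj.
rewrite !rmorphD !rmorphM /=.
by ring: omega_sq.
Qed.

Lemma eisenstein_int (n : int) : eisenstein n%:~R.
Proof. by exists n, 0; rewrite mul0r addr0. Qed.

Lemma eisensteinD x y : eisenstein x -> eisenstein y -> eisenstein (x + y).
Proof.
by move=> [a [b ->]] [c [d ->]]; exists (a + c), (b + d); rewrite !rmorphD; ring.
Qed.

Lemma eisensteinN x : eisenstein x -> eisenstein (- x).
Proof. by move=> [a [b ->]]; exists (- a), (- b); rewrite !rmorphN; ring. Qed.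

Lemma eisensteinB x y : eisenstein x -> eisenstein y -> eisenstein (x - y).
Proof. by move=> hx /eisensteinN; apply: eisensteinD. Qed.

Lemma eisensteinM x y : eisenstein x -> eisenstein y -> eisenstein (x * y).
Proof.
move=> [a [b ->]] [c [d ->]]; exists (a * c - b * d), (a * d + b * c + b * d).
by rewrite !rmorphD rmorphN !rmorphM /=; ring: omega_sq.
Qed.

Lemma eisenstein_inj (a b c d : int) :
  a%:~R + b%:~R * omega = c%:~R + d%:~R * omega -> a = c /\ b = d.
Proof.
move=> /eqP; rewrite -subr_eq0 => /eqP h.
have : `|(a - c)%:~R + (b - d)%:~R * omega : algC| ^+ 2 = 0.
  rewrite [X in `|X|](_ : _ = 0) ?normr0 ?expr0n // -h !rmorphB /=; ring.
rewrite normC_eisenstein => /eqP; rewrite intr_eq0 => /eqP {h}.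
set e := a - c; set f := b - d => h.
(* Positive definiteness: 4(e^2 + ef + f^2) = (2e + f)^2 + 3f^2 = (e + 2f)^2 + 3e^2. *)
have : 0 <= (2 * e + f) ^+ 2 by apply: sqr_ge0.
have : 0 <= (e + 2 * f) ^+ 2 by apply: sqr_ge0.
rewrite !expr2 in h * => h1 h2.
have he : e * e <= 0 by lia.
have hf : f * f <= 0 by lia.
have e0 : e = 0 by clear -he; nia.
have f0 : f = 0 by clear -hf; nia.
by rewrite /e /f in e0 f0; lia.
Qed.

(** The squared absolute values are nonnegative integers with product 1. *)
Lemma eisenstein_norm_div x y :
  eisenstein x -> eisenstein y -> `|x * y| = 1 -> `|x| ^+ 2 = 1.
Proof.
move=> [a [b ->]] [c [d ->]] h.
have : `|a%:~R + b%:~R * omega : algC| ^+ 2 *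
       `|c%:~R + d%:~R * omega : algC| ^+ 2 = 1.
  by rewrite -exprMn -normrM h expr1n.
rewrite !normC_eisenstein -rmorphM /= => /eqP.
rewrite (eqr_int _ _ 1) => /eqP {}h.
set m := (a ^+ 2 + _ + _) in h *; set n := (c ^+ 2 + _ + _) in h.
have : 0 <= m by rewrite /m; nia.
have : 0 <= n by rewrite /n; nia.
clearbody m n => n0 m0; rewrite (_ : m = 1) //.
have n1 : 1 <= n by case: (n =P 0) => [n00|]; [rewrite n00 mulr0 in h|lia].
have m1 : 1 <= m by case: (m =P 0) => [m00|]; [rewrite m00 mul0r in h|lia].
nia.
Qed.

(** Completing the square in either variable gives 3a^2 <= 4 and 3b^2 <= 4. *)
Lemma unit_form_bounds (a b : int) :
  a ^+ 2 + a * b + b ^+ 2 = 1 -> -1 <= a <= 1 /\ -1 <= b <= 1.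
Proof.
move=> h.
have : 0 <= (2 * a + b) ^+ 2 by apply: sqr_ge0.
have : 0 <= (a + 2 * b) ^+ 2 by apply: sqr_ge0.
rewrite !expr2 in h * => h1 h2.
have ha : a * a <= 1 by lia.
have hb : b * b <= 1 by lia.
clear h h1 h2; nia.
Qed.

(* A nonzero difference of two Eisenstein units has norm 1, 3 or 4, and adding 4
   to such a number never gives a square. *)
Lemma eisenstein_sq_unit_diff x u v :
    eisenstein x -> eisenstein u -> eisenstein v ->
    `|u| ^+ 2 = 1 -> `|v| ^+ 2 = 1 -> x ^+ 2 = 4 - u - v ->
  x ^+ 2 = 4.
Proof.
move=> [p [q ->]] [a [b ->]] [c [d ->]].
rewrite !normC_eisenstein => /eqP; rewrite (eqr_int _ _ 1) => /eqP hu.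
move=> /eqP; rewrite (eqr_int _ _ 1) => /eqP hv E.
(* Coordinates of x^2 = 4 - u - v in the basis 1, [omega], using omega^2 = omega - 1. *)
have [h1 h2] : p ^+ 2 - q ^+ 2 = 4 - a - c /\ 2 * p * q + q ^+ 2 = - b - d.
  apply: eisenstein_inj; rewrite !(rmorphB, rmorphD, rmorphM, rmorphN) /=.
  rewrite [LHS](_ : _ = (p%:~R + q%:~R * omega) ^+ 2); last by ring: omega_sq.
  by rewrite E; ring.
have [ha hb] := unit_form_bounds _ _ hu; have [hc hd] := unit_form_bounds _ _ hv.
suff [ac0 bd0] : a + c = 0 /\ b + d = 0.
  rewrite E [RHS](_ : _ = 4 - (a + c)%:~R - (b + d)%:~R * omega).
    by rewrite !rmorphD /=; ring.
  by rewrite ac0 bd0; ring.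
rewrite !expr2 in h1 h2; clear E hu hv.
(* If q = 0, then p^2 = 4 - a - c lies between 2 and 6, so p is 2 or -2 and u + v = 0. If q is
   nonzero, both q and 2p + q turn out to be bounded by 2, and every remaining pair (p, q) is
   contradictory. *)
have [q0|q0] := eqVneq q 0.
  have p2 : -2 <= p <= 2 by rewrite q0 in h1 h2; clear -h1 ha hc; nia.
  rewrite q0 in h1 h2.
  have [] : p = -2 \/ p = 2 \/ -1 <= p <= 1 by lia.
  - by move=> p0; rewrite p0 in h1 h2; lia.
  case=> [p0|p0]; first by rewrite p0 in h1 h2; lia.
  have : p * p <= 1 by clear -p0; nia.
  lia.
have qs : q * (2 * p + q) = - b - d by rewrite -h2; ring.
have hs : -2 <= 2 * p + q <= 2.
  by move: (2 * p + q) qs => t qs; clear -qs q0 hb hd; nia.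
have s0 : 2 * p + q != 0.
  (* Here p^2 - q^2 = -3p^2 <= 0, whereas 4 - a - c >= 2. *)
  apply/eqP=> s0; have qE : q = - (2 * p) by lia.
  by rewrite qE in h1; clear -h1 ha hc; nia.
have hq : -2 <= q <= 2.
  by move: (2 * p + q) s0 qs => t s0 qs; clear -qs s0 hb hd; nia.
have hp : p = -2 \/ p = -1 \/ p = 0 \/ p = 1 \/ p = 2 by lia.
have {}hq : q = -2 \/ q = -1 \/ q = 1 \/ q = 2 by lia.
clear s0 hs qs q0.
by case: hp hq => [|[|[|[|]]]] pE [|[|[|]]] qE; rewrite pE qE in h1 h2; lia.
Qed.

(** * Identities for 2 by 2 matrices *)

Lemma big_ord2 (R : comNzRingType) (F : 'I_2 -> R) :
  \sum_(i < 2) F i = F 0 + F 1.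
Proof.
by rewrite !big_ord_recl big_ord0 addr0; congr (F _ + F _); apply: val_inj.
Qed.

Lemma ord2P (i : 'I_2) : i = 0 \/ i = 1.
Proof. by case: i => [[|[|//]] hi]; [left|right]; apply: val_inj. Qed.

Lemma det_mx22 (R : comNzRingType) (M : 'M[R]_2) :
  \det M = M 0 0 * M 1 1 - M 0 1 * M 1 0.
Proof.
rewrite (expand_det_row _ 0) big_ord2 /cofactor !det_mx11 !mxE.
have -> : lift (0 : 'I_2) (0 : 'I_1) = 1 by apply: val_inj.
have -> : lift (1 : 'I_2) (0 : 'I_1) = 0 by apply: val_inj.
rewrite expr0 expr1; ring.
Qed.

Lemma mxtrace22 (R : comNzRingType) (M : 'M[R]_2) : \tr M = M 0 0 + M 1 1.
Proof. exact: big_ord2. Qed.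

Lemma mx22_cayley_hamilton (R : comNzRingType) (M : 'M[R]_2) :
  M *m M = \tr M *: M - (\det M)%:M.
Proof.
apply/matrixP=> i j; rewrite det_mx22 mxtrace22 !mxE big_ord2.
by case: (ord2P i) (ord2P j) => -> [] ->; rewrite /= ?mulr1n ?mulr0n; ring.
Qed.

(** A homogeneous form of Fricke's trace identity: when both determinants are 1, the left side is 2
    - tr(X Y X^-1 Y^-1). *)
Lemma det_commutator22 (R : comNzRingType) (X Y : 'M[R]_2) :
  \det (X *m Y - Y *m X) =
    4 * \det X * \det Y - \tr X ^+ 2 * \det Y - \tr Y ^+ 2 * \det X
    - \tr (X *m Y) ^+ 2 + \tr X * \tr Y * \tr (X *m Y).
Proof.
by rewrite !det_mx22 !mxtrace22 !mxE !big_ord2; ring.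
Qed.

(** With C = XY - YX, Cayley-Hamilton gives XC + CX = X^2 Y - Y X^2 = (tr X) C. The left factor on
    the right side is the adjugate of X, hence X^-1 when det X = 1. *)
Lemma commutator22_mull (R : comNzRingType) (X Y : 'M[R]_2) :
  (X *m Y - Y *m X) *m X = ((\tr X)%:M - X) *m (X *m Y - Y *m X).
Proof.
apply/matrixP=> i j; rewrite !mxE !big_ord2 mxtrace22 !mxE !big_ord2.
by case: (ord2P i) (ord2P j) => -> [] ->; rewrite /= ?mulr1n ?mulr0n; ring.
Qed.

Lemma commutator22_mulr (R : comNzRingType) (X Y : 'M[R]_2) :
  (X *m Y - Y *m X) *m Y = ((\tr Y)%:M - Y) *m (X *m Y - Y *m X).
Proof.
by rewrite -[_ - _]opprB mulNmx commutator22_mull mulmxN.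
Qed.

Lemma invmx22 (R : comUnitRingType) (M : 'M[R]_2) :
  \det M = 1 -> invmx M = (\tr M)%:M - M.
Proof.
move=> h; have Mu : M \in unitmx by rewrite unitmxE h unitr1.
apply: (can_inj (mulKmx Mu)); rewrite mulmxV // mulmxBr mx22_cayley_hamilton h.
by rewrite mul_mx_scalar subKr.
Qed.

(** * Matrices over O and SL_2(O) *)

Lemma eisenstein_scalar_mx n x : eisenstein x -> eisenstein_mx n x%:M.
Proof.
move=> hx i j; rewrite mxE; case: (i == j); rewrite ?mulr1n ?mulr0n //.
exact: eisenstein_int 0.
Qed.

Lemma eisenstein_mxD n M N :
  eisenstein_mx n M -> eisenstein_mx n N -> eisenstein_mx n (M + N).
Proof. by move=> hM hN i j; rewrite mxE; apply: eisensteinD. Qed.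

Lemma eisenstein_mxN n M : eisenstein_mx n M -> eisenstein_mx n (- M).
Proof. by move=> hM i j; rewrite mxE; apply: eisensteinN. Qed.

Lemma eisenstein_mxM n M N :
  eisenstein_mx n M -> eisenstein_mx n N -> eisenstein_mx n (M *m N).
Proof.
move=> hM hN i j; rewrite mxE; apply: big_ind.
- exact: eisenstein_int 0.
- exact: eisensteinD.
- by move=> k _; apply: eisensteinM.
Qed.

Lemma eisenstein_mxtrace n M : eisenstein_mx n M -> eisenstein (\tr M).
Proof.
move=> hM; apply: big_ind; first exact: eisenstein_int 0.
  exact: eisensteinD.
by move=> k _; apply: hM.
Qed.

Lemma eisenstein_det M : eisenstein_mx 2 M -> eisenstein (\det M).
Proof.
by move=> hM; rewrite det_mx22; apply: eisensteinB; apply: eisensteinM.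
Qed.

Definition eisenstein_SL2 (M : 'M[algC]_2) : Prop :=
  eisenstein_mx 2 M /\ \det M = 1.

Lemma eisenstein_SL2_M M N :
  eisenstein_SL2 M -> eisenstein_SL2 N -> eisenstein_SL2 (M *m N).
Proof.
move=> [hM dM] [hN dN]; split; first exact: eisenstein_mxM.
by rewrite det_mulmx dM dN mulr1.
Qed.

Lemma eisenstein_SL2_inv M : eisenstein_SL2 M -> eisenstein_SL2 (invmx M).
Proof.
move=> [hM dM]; split; last by rewrite det_inv dM invr1.
rewrite invmx22 //; apply: eisenstein_mxD; last exact: eisenstein_mxN.
by apply: eisenstein_scalar_mx; apply: eisenstein_mxtrace.
Qed.

Lemma eisenstein_SL2_word X Y M :
  eisenstein_SL2 X -> eisenstein_SL2 Y -> word_in X Y M -> eisenstein_SL2 M.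
Proof.
move=> hX hY; elim=> [|N _ IH|N _ IH|N _ IH|N _ IH].
- split; last exact: det1.
  by apply: eisenstein_scalar_mx; apply: (eisenstein_int 1).
- exact: eisenstein_SL2_M.
- by apply: eisenstein_SL2_M => //; apply: eisenstein_SL2_inv.
- exact: eisenstein_SL2_M.
- by apply: eisenstein_SL2_M => //; apply: eisenstein_SL2_inv.
Qed.

(** * The left ideal generated by a commutator *)

Definition eisenstein_multiple (C D : 'M[algC]_2) : Prop :=
  exists2 K, eisenstein_mx 2 K & D = K *m C.

Lemma eisenstein_multipleD C D E :
    eisenstein_multiple C D -> eisenstein_multiple C E ->
  eisenstein_multiple C (D + E).
Proof.
move=> [K hK ->] [L hL ->]; exists (K + L); first exact: eisenstein_mxD.
by rewrite mulmxDl.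
Qed.

Lemma eisenstein_multiple_mull C M D :
  eisenstein_mx 2 M -> eisenstein_multiple C D -> eisenstein_multiple C (M *m D).
Proof.
move=> hM [K hK ->]; exists (M *m K); first exact: eisenstein_mxM.
by rewrite mulmxA.
Qed.

Lemma eisenstein_multipleN C D :
  eisenstein_multiple C D -> eisenstein_multiple C (- D).
Proof.
move=> [K hK ->]; exists (- K); first exact: eisenstein_mxN.
by rewrite mulNmx.
Qed.

Lemma eisenstein_multiple_mulr C X X' D :
    eisenstein_mx 2 X' -> C *m X = X' *m C -> eisenstein_multiple C D ->
  eisenstein_multiple C (D *m X).
Proof.
move=> hX' CX [K hK ->]; exists (K *m X'); first exact: eisenstein_mxM.
by rewrite -!mulmxA CX.
Qed.

(** M^-1 = tr M - M, and the scalar part commutes with Z. *)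
Lemma commutator22_invmx (M Z : 'M[algC]_2) :
  \det M = 1 -> invmx M *m Z - Z *m invmx M = - (M *m Z - Z *m M).
Proof.
move=> dM; rewrite invmx22 // mulmxBl mulmxBr mul_scalar_mx mul_mx_scalar.
by rewrite !opprB addrC addrA subrK.
Qed.

(* The left ideal generated by [C := XY - YX] over the Eisenstein integers is
   stable under right multiplication by [X] and [Y], so the commutators that
   lie in it are propagated along words by the Leibniz rule. *)
Lemma commutator_word_multiple X Y Z M :
    eisenstein_SL2 X -> eisenstein_SL2 Y ->
    eisenstein_multiple (X *m Y - Y *m X) (X *m Z - Z *m X) ->
    eisenstein_multiple (X *m Y - Y *m X) (Y *m Z - Z *m Y) ->
  word_in X Y M ->
  eisenstein_multiple (X *m Y - Y *m X) (M *m Z - Z *m M).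
Proof.
set C := X *m Y - Y *m X => hX hY hXZ hYZ.
have [[eX dX] [eY dY]] := (hX, hY).
have [eX' _] := eisenstein_SL2_inv _ hX; have [eY' _] := eisenstein_SL2_inv _ hY.
have CX : C *m X = invmx X *m C by rewrite invmx22 // commutator22_mull.
have CY : C *m Y = invmx Y *m C by rewrite invmx22 // commutator22_mulr.
have swap W : W \in unitmx -> C *m W = invmx W *m C -> C *m invmx W = W *m C.
  by move=> uW CW; apply: (canLR (mulmxK uW)); rewrite -mulmxA CW mulKVmx.
have CX' : C *m invmx X = X *m C by apply: swap; rewrite // unitmxE dX unitr1.
have CY' : C *m invmx Y = Y *m C by apply: swap; rewrite // unitmxE dY unitr1.
have step W W' N : eisenstein_mx 2 W' -> C *m W = W' *m C ->
    eisenstein_multiple C (W *m Z - Z *m W) -> word_in X Y N ->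
    eisenstein_multiple C (N *m Z - Z *m N) ->
    eisenstein_multiple C (N *m W *m Z - Z *m (N *m W)).
  move=> eW' CW hW wN hN; have [eN _] := eisenstein_SL2_word _ _ _ hX hY wN.
  have -> : N *m W *m Z - Z *m (N *m W) =
      N *m (W *m Z - Z *m W) + (N *m Z - Z *m N) *m W.
    by rewrite mulmxBr mulmxBl !mulmxA addrA subrK.
  apply: eisenstein_multipleD; first exact: eisenstein_multiple_mull.
  exact: eisenstein_multiple_mulr eW' CW hN.
elim=> [|N wN IH|N wN IH|N wN IH|N wN IH].
- exists 0; last by rewrite mul1mx mulmx1 subrr mul0mx.
  by move=> i j; rewrite mxE; apply: (eisenstein_int 0).
- exact: step eX' CX _ _ _.
- apply: step eX CX' _ _ _ => //; rewrite commutator22_invmx //.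
  exact: eisenstein_multipleN.
- exact: step eY' CY _ _ _.
- apply: step eY CY' _ _ _ => //; rewrite commutator22_invmx //.
  exact: eisenstein_multipleN.
Qed.

Lemma commutator_words_multiple X Y M N :
    eisenstein_SL2 X -> eisenstein_SL2 Y -> word_in X Y M -> word_in X Y N ->
  eisenstein_multiple (X *m Y - Y *m X) (M *m N - N *m M).
Proof.
move=> hX hY wM wN; set C := X *m Y - Y *m X.
have C0 : eisenstein_multiple C 0.
  exists 0; last by rewrite mul0mx.
  by move=> i j; rewrite mxE; apply: (eisenstein_int 0).
have CC : eisenstein_multiple C C.
  exists 1%:M; last by rewrite mul1mx.
  by apply: eisenstein_scalar_mx; apply: (eisenstein_int 1).
have anti (P Q : 'M[algC]_2) : eisenstein_multiple C (P *m Q - Q *m P) ->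
    eisenstein_multiple C (Q *m P - P *m Q).
  by move=> /eisenstein_multipleN; rewrite opprB.
(* Induction on the word M leaves the commutators of X and Y with N. After a swap of sides,
   induction on N leaves those of the generators, which are 0, C and -C. *)
apply: commutator_word_multiple => //; apply/anti;
  apply: commutator_word_multiple => //; rewrite ?subrr //.
by apply/anti.
Qed.

(** * Generating pairs of Gamma *)

Lemma eisenstein_SL2_mA : eisenstein_SL2 mA.
Proof.
split; last by rewrite det_mx22 !mxE /=; ring.
move=> i j; rewrite mxE; case: ifP => _; first exact: eisenstein_int 0.
exact: eisenstein_int 1.
Qed.

Lemma eisenstein_SL2_mB : eisenstein_SL2 mB.
Proof.
split; last by rewrite det_mx22 !mxE /=; ring.
move=> i j; rewrite mxE; case: ifP => _; first exact: eisenstein_int 0.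
case: ifP => _; last exact: eisenstein_int 1.
by exists 0, 1; ring.
Qed.

Lemma det_commutator_AB : \det (mA *m mB - mB *m mA) = - omega ^+ 2.
Proof. by rewrite det_mx22 !mxE !big_ord2 !mxE /=; ring. Qed.

Lemma normC_omega : `|omega| = 1.
Proof.
apply/eqP; rewrite -(@pexpr_eq1 _ _ 2) //.
have -> : omega = 0%:~R + 1%:~R * omega by ring.
by rewrite normC_eisenstein.
Qed.

Lemma in_Gamma_SL2 M : in_Gamma M -> eisenstein_SL2 M.
Proof.
have hN P : eisenstein_SL2 P -> eisenstein_SL2 (- P).
  move=> [eP dP]; split; first exact: eisenstein_mxN.
  by rewrite -scaleN1r detZ dP mulr1 expr2 mulrNN mulr1.
case=> /(eisenstein_SL2_word _ _ _ eisenstein_SL2_mA eisenstein_SL2_mB) //.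
by move=> /hN; rewrite opprK.
Qed.

(** Some lifts of A and B are words in X and Y, so their commutator is K(XY - YX) with K over O. Its
    determinant is -omega^2, of absolute value 1, and k = det K. *)
Lemma generates_Gamma_det X Y :
    eisenstein_SL2 X -> eisenstein_SL2 Y -> generates_Gamma X Y ->
  exists2 k, eisenstein k & `|\det (X *m Y - Y *m X) * k| = 1.
Proof.
move=> hX hY gen.
have lift M : word_in mA mB M ->
    exists s : bool, word_in X Y ((-1) ^+ s *: M).
  move=> /gen [] h; first by exists false; rewrite ?expr0 ?scale1r.
  by exists true; rewrite ?expr1 ?scaleN1r.
have [s wA] : exists s : bool, word_in X Y ((-1) ^+ s *: mA).
  apply: lift; rewrite -[X in word_in _ _ X]mul1mx.
  by apply: word_X; apply: word_one.
have [t wB] : exists s : bool, word_in X Y ((-1) ^+ s *: mB).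
  apply: lift; rewrite -[X in word_in _ _ X]mul1mx.
  by apply: word_Y; apply: word_one.
have [K eK] := commutator_words_multiple _ _ _ _ hX hY wA wB.
(* The signs of the two lifts factor out of the commutator and vanish in the absolute value of the
   determinant. *)
rewrite -!scalemxAl -!scalemxAr [(-1) ^+ t *: ((-1) ^+ s *: _)]scalerA mulrC.
rewrite -scalerA -!scalerBr => /(congr1 (fun D => `|\det D|)).
rewrite det_mulmx !detZ det_commutator_AB !normrM !normrX !normrN1 !expr1n !mul1r.
rewrite normrN normrX normC_omega expr1n => E.
by exists (\det K); [apply: eisenstein_det | rewrite mulrC normrM -E].
Qed.

(** The first factor is the commutator determinant for traces x, x, z. It splits as uv with u = 2 -
    z and v = z + 2 - x^2, both dividing a unit, and u + v = 4 - x^2. *)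
Lemma unit_commutator_sq_trace x z k :
    eisenstein x -> eisenstein z -> eisenstein k ->
    `|(4 - x ^+ 2 - x ^+ 2 - z ^+ 2 + x ^+ 2 * z) * k| = 1 ->
  x ^+ 2 = 4.
Proof.
move=> ex ez ek.
have e2 : eisenstein 2 by exact: eisenstein_int 2.
have eu : eisenstein (2 - z) by exact: eisensteinB.
have ev : eisenstein (z + 2 - x ^+ 2).
  by apply: eisensteinB; [apply: eisensteinD | rewrite expr2; apply: eisensteinM].
have -> : 4 - x ^+ 2 - x ^+ 2 - z ^+ 2 + x ^+ 2 * z = (2 - z) * (z + 2 - x ^+ 2).
  by ring.
move=> h; apply: (eisenstein_sq_unit_diff x (2 - z) (z + 2 - x ^+ 2)) => //.
- by apply: eisenstein_norm_div (eisensteinM _ _ ev ek) _; rewrite // mulrA.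
- by apply: eisenstein_norm_div (eisensteinM _ _ eu ek) _; rewrite // mulrCA mulrA.
- by ring.
Qed.

Theorem theorem1p2 (X Y : 'M[algC]_2) :
  in_Gamma X -> in_Gamma Y -> generates_Gamma X Y -> tr_eq_pm X Y ->
  parabolic X /\ parabolic Y.
Proof.
move=> /in_Gamma_SL2 hX /in_Gamma_SL2 hY gen trXY.
have [k ek] := generates_Gamma_det _ _ hX hY gen.
have [[eX dX] [eY dY]] := (hX, hY).
have sq : \tr Y ^+ 2 = \tr X ^+ 2 by case: trXY => ->; rewrite ?sqrrN.
have ez : eisenstein (\tr (X *m Y)) by apply/eisenstein_mxtrace/eisenstein_mxM.
have ex : eisenstein (\tr X) by apply: eisenstein_mxtrace.
(* A scalar P commutes with Q, which would make the determinant vanish. *)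
have nontriv (P Q : 'M[algC]_2) : `|\det (P *m Q - Q *m P) * k| = 1 ->
    P <> 1%:M /\ P <> - 1%:M.
  have scal (c : algC) : `|\det (c%:M *m Q - Q *m c%:M) * k| <> 1.
    rewrite mul_scalar_mx mul_mx_scalar subrr det0 mul0r normr0 => /eqP.
    by rewrite eq_sym oner_eq0.
  move=> h; split=> PE; rewrite PE in h; first exact: (scal 1).
  by apply: (scal (-1)); rewrite -scalemx1 scaleN1r.
move=> h; have [X1 XN1] := nontriv _ _ h.
have [Y1 YN1] : Y <> 1%:M /\ Y <> - 1%:M.
  by apply: (nontriv Y X); rewrite -opprB -scaleN1r detZ expr2 mulrNN !mul1r.
suff sqX : \tr X ^+ 2 = 4 by rewrite /parabolic sq sqX.
rewrite det_commutator22 dX dY sq !mulr1 in h.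
case: trXY => trY.
  apply: (unit_commutator_sq_trace (\tr X) (\tr (X *m Y)) k) => //.
  by rewrite -[RHS]h -trY; congr (`|_ * _|); ring.
(* Opposite traces: replacing Y by -Y makes them equal and negates tr XY. *)
apply: (unit_commutator_sq_trace (\tr X) (- \tr (X *m Y)) k) => //.
  exact: eisensteinN.
rewrite -[RHS]h (_ : \tr Y = - \tr X); last by rewrite trY opprK.
by congr (`|_ * _|); ring.
Qed.
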